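(* Let $(C,X,F,Y)$ be random elements of standard Borel spaces such that $F-(X,C)-Y$ is a Markov chain. Let $L:\mathcal Q\times\mathcal F\to\overline{\mathbb R}$ be proper on $\mathcal Q\subseteq\mathcal P(\mathcal F)$, suppose that $S_X,S_Y\in\mathcal Q$ almost surely, let $\mathcal V$ be a nonempty class of measurable predictive kernels with $Q(\cdot\mid Y,C)\in\mathcal Q$ almost surely for every $Q\in\mathcal V$, and let $Q_\theta\in\mathcal V$. Assume that all risks displayed below are finite. Then $$H_L(F\mid X,C)\le H_L(F\mid Y,C)\le H_{L,\mathcal V}(F\mid Y,C)\le\mathcal R_L(Q_\theta).$$ Define $$\Delta_{\rm comm}\triangleq H_L(F\mid Y,C)-H_L(F\mid X,C),$$ $$\Delta_{\rm family}^{\mathcal V}\triangleq H_{L,\mathcal V}(F\mid Y,C)-H_L(F\mid Y,C),$$ $$\Delta_{\rm deploy}^{\theta}\triangleq\mathcal R_L(Q_\theta)-H_{L,\mathcal V}(F\mid Y,C).$$ Then $$\Delta_{\rm comm}=\mathbb E\,D_L(S_X\|S_Y),\qquad \Delta_{\rm family}^{\mathcal V}=\inf_{Q\in\mathcal V}\mathbb E\,D_L\left(S_Y\,\middle\|\,Q(\cdot\mid Y,C)\right),$$ all three gaps are nonnegative, and $$\mathbb E\,D_L\left(S_X\,\middle\|\,Q_\theta(\cdot\mid Y,C)\right)=\Delta_{\rm comm}+\Delta_{\rm family}^{\mathcal V}+\Delta_{\rm deploy}^{\theta}.$$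
   Context: All random elements take values in standard Borel spaces; $\mathcal P(\mathcal F)$ is the space of probability measures on $\mathcal F$ with its evaluation $\sigma$-field, and the report class $\mathcal Q\subseteq\mathcal P(\mathcal F)$ carries the trace $\sigma$-field. The loss $L$ is measurable. $F-(X,C)-Y$ means that $F$ and $Y$ are conditionally independent given $(X,C)$. $S_X=P_{F\mid X,C}(\cdot\mid X,C)$ and $S_Y=P_{F\mid Y,C}(\cdot\mid Y,C)$ are the conditional laws of $F$ given $(X,C)$ and given $(Y,C)$. For $P,Q\in\mathcal Q$: $R_L(P,Q)\triangleq\mathbb E_{F\sim P}[L(Q,F)]$. $L$ is *proper* on $\mathcal Q$ if $R_L(P,P)\le R_L(P,Q)$ for all $P,Q\in\mathcal Q$. $H_L(P)\triangleq R_L(P,P)$; whenever the difference is well defined, $D_L(P\|Q)\triangleq R_L(P,Q)-R_L(P,P)$. For $U\in\{X,Y\}$, $H_L(F\mid U,C)\triangleq\mathbb E[H_L(S_U)]$. $\mathcal V$ consists of measurable kernels $Q:(y,c)\mapsto Q(\cdot\mid y,c)\in\mathcal Q$. For $Q\in\mathcal V$, $\mathcal R_L(Q)\triangleq\mathbb E[L(Q(\cdot\mid Y,C),F)]$, and $H_{L,\mathcal V}(F\mid Y,C)\triangleq\inf_{Q\in\mathcal V}\mathcal R_L(Q)$. *)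

(* Defs.v *)
From HB Require Import structures.
From mathcomp Require Import all_boot all_order all_algebra.
From mathcomp Require Import all_classical all_reals all_analysis.
From mathcomp Require Import measurable_realfun.

Set Implicit Arguments.
Unset Strict Implicit.
Unset Printing Implicit Defensive.

Import Order.TTheory GRing.Theory Num.Theory.
Import numFieldNormedType.Exports.

Local Open Scope classical_set_scope.
Local Open Scope ereal_scope.

(* Up to a bijection [f], the sigma-algebra of [T] is the Borel sigma-algebra
   of a Polish space.  The balls of a [completePseudoMetricType] need not
   separate points, hence the Hausdorff clause. *)
Definition standard_borel (R : realType) (d : measure_display)
    (T : measurableType d) : Prop :=
  exists M : completePseudoMetricType R,
    [/\ hausdorff_space M,
        (exists2 D : set M, countable D & dense D)
      & exists2 f : T -> M, bijective f &
          @measurable d T = [set f @^-1` B | B in <<s @open M >>] ].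

(* Measurability of the restriction of [f] to [D] for the trace
   sigma-algebra.  [measurable_fun D f] is void when [D] is not measurable,
   whereas [D] is arbitrary here.  For [D = Q `*` setT] the trace of the
   product sigma-algebra is the product of the trace on [Q] with the
   sigma-algebra of the second factor. *)
Definition trace_measurable_fun (d d' : measure_display)
    (T : measurableType d) (T' : measurableType d')
    (D : set T) (f : T -> T') : Prop :=
  forall B, measurable B ->
    exists2 A, measurable A & D `&` f @^-1` B = D `&` A.

Section conditioning.
Context (R : realType) (dO dU dF dY : measure_display).
Context (Omega : measurableType dO) (TU : measurableType dU).
Context (TF : measurableType dF) (TY : measurableType dY).
Variable P : probability Omega R.

(* [g \o U] is a version of the conditional probability of [E] given [U]. *)
Definition is_cond_prob (U : Omega -> TU) (E : set Omega)
    (g : TU -> \bar R) : Prop :=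
  measurable_fun [set: TU] g /\
  forall A, measurable A ->
    P (U @^-1` A `&` E) = \int[P]_(w in U @^-1` A) g (U w).

(* [k] is a regular conditional law of [F] given [U].  The measurable space
   [pprobability TF R] carries the sigma-algebra generated by the
   evaluations, so [k] is a probability kernel. *)
Definition is_cond_law (U : Omega -> TU) (F : Omega -> TF)
    (k : {mfun TU >-> pprobability TF R}) : Prop :=
  forall B, measurable B -> is_cond_prob U (F @^-1` B) (fun u => k u B).

(* P(F \in A, Y \in B | U) = P(F \in A | U) P(Y \in B | U) almost surely. *)
Definition cond_indep (U : Omega -> TU) (F : Omega -> TF)
    (Y : Omega -> TY) : Prop :=
  forall (A : set TF) (B : set TY), measurable A -> measurable B ->
    exists a b : TU -> \bar R,
      [/\ is_cond_prob U (F @^-1` A) a,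
          is_cond_prob U (Y @^-1` B) b
        & is_cond_prob U (F @^-1` A `&` Y @^-1` B) (fun u => a u * b u)].

End conditioning.

(* A loss is a total function of the report; only its values on the report
   class are ever constrained.  An integral whose positive and negative parts
   are both infinite is [-oo] by convention: a finiteness assumption on an
   integral therefore also says that it is well defined. *)
Section loss.
Context (R : realType) (dF : measure_display) (TF : measurableType dF).
Implicit Types (L : pprobability TF R -> TF -> \bar R).
Implicit Types (p q : pprobability TF R).

Definition expected_loss L p q : \bar R := \int[p]_f L q f.

Definition proper_loss (Q : set (pprobability TF R)) L : Prop :=
  forall p q, Q p -> Q q -> expected_loss L p p <= expected_loss L p q.

Definition entropy L p : \bar R := expected_loss L p p.

Definition divergence L p q : \bar R :=
  expected_loss L p q - expected_loss L p p.

End loss.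

Section risks.
Context (R : realType) (dO dU dF : measure_display).
Context (Omega : measurableType dO) (TU : measurableType dU).
Context (TF : measurableType dF).
Variable P : probability Omega R.
Variable L : pprobability TF R -> TF -> \bar R.

(* [S] is the random conditional law of the target. *)
Definition cond_entropy (S : Omega -> pprobability TF R) : \bar R :=
  \int[P]_w entropy L (S w).

Definition mean_divergence (S S' : Omega -> pprobability TF R) : \bar R :=
  \int[P]_w divergence L (S w) (S' w).

Definition risk (U : Omega -> TU) (F : Omega -> TF)
    (k : {mfun TU >-> pprobability TF R}) : \bar R :=
  \int[P]_w L (k (U w)) (F w).

Definition family_entropy (U : Omega -> TU) (F : Omega -> TF)
    (V : set {mfun TU >-> pprobability TF R}) : \bar R :=
  ereal_inf [set risk U F k | k in V].

End risks.

(* Main.v *)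
(* Off a null set, properness makes the excess [R_L(S, S') - H_L(S)] of a report
   [S'] over the true conditional law [S] nonnegative, so its mean is the
   difference of the two risks as soon as the risk of [S'] can be computed by
   disintegrating along [S].  The Markov property says that S_X is also the
   conditional law of F given (X, C, Y), of which every report in (Y, C) is a
   function; hence E D(S_X || Q) = R(Q) - H(F | X, C), and likewise
   E D(S_Y || Q) = R(Q) - H(F | Y, C).  The remaining claims follow by taking
   differences and infima. *)
Require Import Defs.
From HB Require Import structures.
From mathcomp Require Import all_boot all_order all_algebra.
From mathcomp Require Import all_classical all_reals all_analysis.
From mathcomp Require Import measurable_realfun.
From mathcomp Require Import ring lra.

Set Implicit Arguments.
Unset Strict Implicit.
Unset Printing Implicit Defensive.

Import Order.TTheory GRing.Theory Num.Theory.
Import numFieldNormedType.Exports.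

Local Open Scope classical_set_scope.
Local Open Scope ereal_scope.

(** * Integrals of almost everywhere equal functions *)

Section ae_eq_integral.
Import HBNNSimple.

(** The integral of a nonnegative function is a supremum over the simple functions below it. A
    simple function below [f], once set to zero on the exceptional null set, lies below [g] and
    keeps its integral. *)
Lemma ge0_integral_ae_le d (T : measurableType d) (R : realType)
    (mu : measure T R) (f g : T -> \bar R) :
  (forall x, 0 <= f x) -> (forall x, 0 <= g x) ->
  {ae mu, forall x, f x = g x} -> \int[mu]_x f x <= \int[mu]_x g x.
Proof.
move=> f0 g0 [N [mN N0 fgN]]; rewrite !ge0_integralTE//.
apply: ge_ereal_sup => _ [h /= hf <-].
pose h' : {nnsfun T >-> R} := mul_nnsfun h (indic_nnsfun R (measurableC mN)).
have hh' : ae_eq mu setT (EFin \o h) (EFin \o h').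
  exists N; split => // x /= /not_implyP[_ hx]; apply: contrapT => xN.
  by apply: hx; rewrite /h' /= mindicE mem_set//= mulr1.
apply: ereal_sup_ubound => /=; exists h'.
  move=> x; rewrite /h' /= mindicE; case: (boolP (x \in ~` N)) => xN.
    rewrite mulr1 (_ : g x = f x) //; apply: contrapT => fg.
    by move: xN; rewrite inE; apply; apply: fgN => /esym.
  by rewrite mulr0.
rewrite -!integralT_nnsfun; apply/esym/ae_eq_integral => //.
- exact/measurable_EFinP.
- exact/measurable_EFinP.
Qed.

End ae_eq_integral.

Lemma ge0_integral_ae_eq d (T : measurableType d) (R : realType)
    (mu : measure T R) (f g : T -> \bar R) :
  (forall x, 0 <= f x) -> (forall x, 0 <= g x) ->
  {ae mu, forall x, f x = g x} -> \int[mu]_x f x = \int[mu]_x g x.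
Proof.
move=> f0 g0 fg; apply/eqP; rewrite eq_le !ge0_integral_ae_le//.
by apply: filterS fg => x ->.
Qed.

(* Contrary to [ae_eq_integral], no measurability is required: the raw loss
   is only measurable on the report class. *)
Lemma integral_ae_eq_fun d (T : measurableType d) (R : realType)
    (mu : measure T R) (D : set T) (f g : T -> \bar R) :
  ae_eq mu D f g ->
  \int[mu]_(x in D) f x = \int[mu]_(x in D) g x.
Proof.
move=> fg; rewrite integral_mkcond [RHS]integral_mkcond integralE [RHS]integralE.
have fgD : {ae mu, forall x, (f \_ D) x = (g \_ D) x}.
  by apply: filterS fg => x fgx; rewrite !patchE; case: ifPn => // /set_mem/fgx.
by congr (_ - _); apply: ge0_integral_ae_eq => //; apply: filterS fgD => x fgx;
  rewrite ?funeposE ?funenegE fgx.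
Qed.

(** * Measurable extension of a function measurable for a trace sigma-algebra *)

Lemma exists_rat_between (R : realType) (x y : \bar R) : x < y ->
  exists q : rat, x < (ratr q)%:E < y.
Proof.
case: x y => [x| |] [y| |]//.
- rewrite lte_fin => /rat_in_itvoo[q]; rewrite in_itv/= => /andP[xq qy].
  by exists q; rewrite !lte_fin xq qy.
- move=> _; have /rat_in_itvoo[q] : (x < x + 1)%R by rewrite ltrDl.
  by rewrite in_itv/= => /andP[xq _]; exists q; rewrite lte_fin xq ltry.
- move=> _; have /rat_in_itvoo[q] : (y - 1 < y)%R by rewrite ltrBlDr ltrDl.
  by rewrite in_itv/= => /andP[_ qy]; exists q; rewrite lte_fin qy ltNyr.
- by move=> _; exists 0%R; rewrite ltNyr ltry.
Qed.

(* The extension is [x |-> inf {q | x \in A q}], where [A q] is a measurable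
   set with the same trace on [D] as [[set x | f x < q]], for [q] rational. *)
Lemma trace_measurable_fun_ext d (T : measurableType d) (R : realType)
    (D : set T) (f : T -> \bar R) : trace_measurable_fun D f ->
  exists2 g, measurable_fun [set: T] g & forall x, D x -> f x = g x.
Proof.
move=> mf.
have mlt (q : rat) : exists A : set T, measurable A /\
    forall x, D x -> (f x < (ratr q)%:E) = `[< A x >].
  have [A mA DA] := mf `]-oo, (ratr q)%:E[%classic (emeasurable_itv _).
  exists A; split => // x Dx; apply/idP/asboolP => [fq|Ax].
    suff [] : (D `&` A) x by [].
    by rewrite -DA; split => //=; rewrite in_itv.
  suff [_ /=] : (D `&` f @^-1` `]-oo, (ratr q)%:E[) x by rewrite in_itv.
  by rewrite DA.
have {mlt}[A HA] := choice mlt.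
pose g x : \bar R := ereal_inf [set (ratr q)%:E | q in [set q : rat | A q x]].
exists g.
  apply: (measurability _ (ErealGenInftyO.measurableE R)) => _ /= -[_ [r ->] <-].
  rewrite setTI (_ : _ @^-1` _ =
      \bigcup_(q : rat) if (ratr q < r)%R then A q else set0).
    apply: countable_bigcupT_measurable; first exact: countableP.
    by move=> q; case: ifP => _; [exact: (HA q).1|exact: measurable0].
  apply/seteqP; split => [x/=|x [q _]].
    rewrite in_itv/= => /ereal_inf_lt[_ [q /= Aqx <-]]; rewrite lte_fin => qr.
    by exists q => //; rewrite qr.
  case: ifPn => // qr Aqx /=; rewrite in_itv/=; apply: le_lt_trans (_ : (ratr q)%:E < _).
    by apply: ereal_inf_lbound; exists q.
  by rewrite lte_fin.
move=> x Dx; apply/eqP; rewrite eq_le; apply/andP; split.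
  apply: le_ereal_inf_tmp => _ [q /= Aqx <-]; apply/ltW.
  by rewrite (HA q).2//; apply/asboolP.
rewrite leNgt; apply/negP => /exists_rat_between[q /andP[fq]].
apply/negP; rewrite -leNgt; apply: ereal_inf_lbound; exists q => //=.
by apply/asboolP; rewrite -(HA q).2.
Qed.

(** * Measures on products, kernels and disintegration *)

Lemma finite_measure_eq_rectangles d1 d2 (T1 : measurableType d1)
    (T2 : measurableType d2) (R : realType) (m1 m2 : measure (T1 * T2)%type R) :
  m1 setT < +oo ->
  (forall A B, measurable A -> measurable B -> m1 (A `*` B) = m2 (A `*` B)) ->
  forall E, measurable E -> m1 E = m2 E.
Proof.
move=> m1oo m12 E mE.
apply: (measure_unique [set A `*` B | A in measurable & B in measurable]
  (fun=> setT)) => //.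
- exact: measurable_prod_measurableType.
- move=> _ _ [A mA [B mB <-]] [A' mA' [B' mB' <-]].
  exists (A `&` A'); first exact: measurableI.
  by exists (B `&` B'); [exact: measurableI|rewrite setXI].
- by move=> _; exists setT => //; exists setT => //; rewrite setXTT.
- by apply/seteqP; split => // x _; exists 0%N.
- by move=> _ [A mA [B mB <-]]; exact: m12.
Qed.

Lemma measurable_eval d d' (T : measurableType d) (T' : measurableType d')
    (R : realType) (k : {mfun T >-> pprobability T' R}) (B : set T') :
  measurable B -> measurable_fun [set: T] (fun x => k x B).
Proof. exact: (measurable_kernel (kprobability (measurable_funPT k))). Qed.

Lemma ge0_measurable_fun_integral_mfun d d' (T : measurableType d)
    (T' : measurableType d') (R : realType) (k : {mfun T >-> pprobability T' R})
    (phi : T * T' -> \bar R) :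
  measurable_fun [set: T * T'] phi -> (forall x, 0 <= phi x) ->
  measurable_fun [set: T] (fun x => \int[k x]_y phi (x, y)).
Proof.
move=> mphi phi0.
exact: (measurable_fun_integral_finite_kernel phi
  (kprobability (measurable_funPT k))).
Qed.

(* The kernel [w |-> \d_(U w) \x k (U w)], which turns the disintegration of the
   law of [(U, F)] into a composition of kernels. *)
Section graph_kernel.
Context d d1 d2 (Omega : measurableType d) (T1 : measurableType d1)
  (T2 : measurableType d2) (R : realType).
Variables (U : {mfun Omega >-> T1}) (k : {mfun T1 >-> pprobability T2 R}).

Let pair1_mfun (u : T1) : {mfun T2 >-> (T1 * T2)%type} :=
  HB.pack (pair u) (isMeasurableFun.Build _ _ _ _ _ (pair1_measurable u)).

Definition graph_kernel (x : unit * Omega) : measure (T1 * T2)%type R :=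
  distribution (k (U x.2)) (pair1_mfun (U x.2)).

Let graph_kernelE x A :
  graph_kernel x A = k (U x.2) (xsection A (U x.2)).
Proof. by rewrite xsectionE. Qed.

Let measurable_graph_kernel A :
  measurable A -> measurable_fun setT (graph_kernel ^~ A).
Proof.
move=> mA.
rewrite (_ : (fun _ => _) = (fun u => k u (xsection A u)) \o (U \o snd)); last first.
  by apply/funext => x; exact: graph_kernelE.
apply: measurableT_comp; last exact: measurableT_comp.
by apply: (measurable_fun_xsection_finite_kernel
  (kprobability (measurable_funPT k))); rewrite inE.
Qed.

HB.instance Definition _ := isKernel.Build _ _ _ _ _ graph_kernel
  measurable_graph_kernel.

Let graph_kernelT x : graph_kernel x setT = 1.
Proof. exact: probability_setT. Qed.

HB.instance Definition _ := Kernel_isProbability.Build _ _ _ _ _ graph_kernel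
  graph_kernelT.

End graph_kernel.

Section conditioning.
Context d dU dF (Omega : measurableType d) (TU : measurableType dU)
  (TF : measurableType dF) (R : realType) (P : probability Omega R).
Variable U : {mfun Omega >-> TU}.

(** The change of variables is made on the positive and the negative part separately, so the
    identity also covers functions that are not integrable. *)
Lemma integral_distributionE (A : set TU) (g : TU -> \bar R) :
  measurable A -> measurable_fun setT g ->
  \int[distribution P U]_(u in A) g u = \int[P]_(w in U @^-1` A) g (U w).
Proof.
move=> mA mg; rewrite integralE [RHS]integralE.
congr (_ - _).
  rewrite ge0_integral_pushforward//; last exact/measurable_funTS/measurable_funepos.
  by apply: eq_integral => w _; rewrite /= !funeposE.
rewrite ge0_integral_pushforward//; last exact/measurable_funTS/measurable_funeneg.
by apply: eq_integral => w _; rewrite /= !funenegE.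
Qed.

(** By the defining property of a conditional law, the law of [(U, F)] and the mixture of the
    measures [gk] over [P] agree on rectangles, hence everywhere. Integration against the mixture is
    the iterated integral. *)
Lemma integral_cond_law (F : {mfun Omega >-> TF})
    (k : {mfun TU >-> pprobability TF R}) (phi : TU * TF -> \bar R) :
  is_cond_law P U F k -> measurable_fun setT phi -> (forall x, 0 <= phi x) ->
  \int[P]_w phi (U w, F w) = \int[P]_w \int[k (U w)]_f phi (U w, f).
Proof.
move=> kP mphi phi0.
have mUF : measurable_fun setT (fun w => (U w, F w)) by exact: measurable_fun_pair.
(* [P] is seen as a constant kernel on the one-point space, so that composing it with [gk] yields a
   measure at [tt]. *)
pose l := kprobability (measurable_cst (P : pprobability Omega R) :
  measurable_fun [set: unit] _).
pose gk := graph_kernel U k.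
transitivity (\int[pushforward P (fun w => (U w, F w))]_x phi x).
  by rewrite ge0_integral_pushforward.
rewrite (eq_measure_integral (kcomp l gk tt)); last first.
  move=> E mE _; apply: finite_measure_eq_rectangles => // [|A B mA mB].
    by rewrite /= /pushforward preimage_setT probability_setT ltry.
  rewrite /= /pushforward /kcomp (_ : _ @^-1` _ = U @^-1` A `&` F @^-1` B)//.
  rewrite (kP B mB).2// [LHS]integral_mkcond; apply: eq_integral => w _.
  rewrite patchE /gk /graph_kernel /distribution /pushforward /=; case: ifPn => Aw.
    congr (k _ _); apply/seteqP; split => [x Bx|x []//].
    by split => //; exact: set_mem.
  transitivity (k (U w) set0); first by rewrite measure0.
  congr (k _ _); apply/seteqP; split => // x [/= AU _].
  by move: Aw; rewrite notin_setE.
rewrite integral_kcomp//; apply: eq_integral => w _.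
by rewrite /gk /graph_kernel /distribution ge0_integral_pushforward.
Qed.

End conditioning.

(** An integral with infinite positive and negative parts is [-oo] by convention, so a finite value
    bounds both parts. *)
Lemma integrable_of_fin_num d (T : measurableType d) (R : realType)
    (mu : measure T R) (D : set T) (f : T -> \bar R) :
  measurable D -> measurable_fun D f -> \int[mu]_(x in D) f x \is a fin_num ->
  mu.-integrable D f.
Proof.
move=> mD mf; rewrite fin_num_abs => foo; apply/integrableP; split => //.
exact/abse_integralP.
Qed.

Lemma ge0_integral_mrestr d (T : measurableType d) (R : realType)
    (mu : measure T R) (D E : set T) (mD : measurable D) (f : T -> \bar R) :
  measurable E -> measurable_fun E f -> (forall x, E x -> 0 <= f x) ->
  \int[mrestr mu mD]_(x in E) f x = \int[mu]_(x in E `&` D) f x.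
Proof.
move=> mE mf f0; rewrite [LHS](ge0_negligible_integral (measurableC mD))//; last first.
  by rewrite /= /mrestr setICl measure0.
rewrite setDE setCK; apply: eq_measure_integral => A mA AED.
by rewrite /= /mrestr setIidl// => x /AED[].
Qed.

(** * Conditional probabilities, conditional independence and localized disintegration *)

Section restricted_law.
Context d dU (Omega : measurableType d) (TU : measurableType dU) (R : realType)
  (P : probability Omega R) (U : {mfun Omega >-> TU}).
Variables (E : set Omega) (mE : measurable E).

(** The density of this measure with respect to the law of [U] is the conditional probability of [E]
    given [U]. *)
Definition restr_law : set TU -> \bar R := pushforward (mrestr P mE) U.

Let restr_law0 : restr_law set0 = 0.
Proof. exact: measure0. Qed.

Let restr_law_ge0 A : 0 <= restr_law A.
Proof. exact: measure_ge0. Qed.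

Let restr_law_sigma_additive : semi_sigma_additive restr_law.
Proof. exact: measure_semi_sigma_additive. Qed.

HB.instance Definition _ := isMeasure.Build _ _ _ restr_law
  restr_law0 restr_law_ge0 restr_law_sigma_additive.

Let restr_law_fin : fin_num_fun restr_law.
Proof.
move=> A mA; rewrite /restr_law /pushforward /mrestr.
apply: fin_num_measure; apply: measurableI => //.
exact: measurable_funPTI.
Qed.

HB.instance Definition _ := Measure_isFinite.Build _ _ _ restr_law restr_law_fin.

Lemma ge0_integral_restr_law (A : set TU) (f : TU -> \bar R) :
  measurable A -> measurable_fun setT f -> (forall u, 0 <= f u) ->
  \int[restr_law]_(u in A) f u = \int[P]_(w in U @^-1` A `&` E) f (U w).
Proof.
move=> mA mf f0; rewrite ge0_integral_pushforward//; last exact: measurable_funTS.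
rewrite ge0_integral_mrestr//.
- exact: measurable_funPTI.
- by apply: measurable_funTS; exact: measurableT_comp.
- by move=> w _; exact: f0.
Qed.

End restricted_law.

Section density_law.
Context d dU (Omega : measurableType d) (TU : measurableType dU) (R : realType)
  (P : probability Omega R) (U : {mfun Omega >-> TU}).
Variable h : Omega -> \bar R.

(** This is the image under [U] of the measure with density [h]. The two proofs are arguments of the
    definition so that the measure structure declared below can be inferred from the term. *)
Definition density_law & measurable_fun setT h & (forall w, 0 <= h w) :
  set TU -> \bar R := fun A => \int[P]_(w in U @^-1` A) h w.

Hypotheses (mh : measurable_fun setT h) (h0 : forall w, 0 <= h w).
Local Notation nu := (density_law mh h0).

Let density_law0 : nu set0 = 0.
Proof. by rewrite /density_law preimage_set0 integral_set0. Qed.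

Let density_law_ge0 A : 0 <= nu A.
Proof. exact: integral_ge0. Qed.

Let density_law_sigma_additive : semi_sigma_additive nu.
Proof.
move=> A mA tA mUA; rewrite /density_law preimage_bigcup ge0_integral_bigcup//.
- apply: is_cvg_ereal_nneg_natsum_cond => n _ _; exact: density_law_ge0.
- by move=> n; exact: measurable_funPTI.
- exact: measurable_funTS.
- apply/trivIsetP => i j _ _ ij; rewrite -preimage_setI.
  by move/trivIsetP : tA => -> //; rewrite preimage_set0.
Qed.

HB.instance Definition _ := isMeasure.Build _ _ _ nu
  density_law0 density_law_ge0 density_law_sigma_additive.

End density_law.

Section conditional_independence.
Context d dU dF dY (Omega : measurableType d) (TU : measurableType dU)
  (TF : measurableType dF) (TY : measurableType dY) (R : realType)
  (P : probability Omega R).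
Variables (U : {mfun Omega >-> TU}) (F : {mfun Omega >-> TF})
  (Y : {mfun Omega >-> TY}).

(** Both versions have the same integral over every measurable set under the law of [U], and [g] is
    integrable because its total integral is [P E]. *)
Lemma is_cond_prob_ae_eq (E : set Omega) (g g' : TU -> \bar R) :
  measurable E -> is_cond_prob P U E g -> is_cond_prob P U E g' ->
  ae_eq (distribution P U) setT g g'.
Proof.
move=> mE [mg gE] [mg' g'E]; apply: integral_ae_eq => //.
  apply: integrable_of_fin_num => //.
  rewrite integral_distributionE// -gE// preimage_setT setTI.
  exact: fin_num_measure.
by move=> A _ mA; rewrite !integral_distributionE// -gE// -g'E.
Qed.

(* A version [b] of P(Y \in B | U) is only unique up to null sets, and may
   take negative or infinite values there; replacing it by a Radon-Nikodym
   derivative makes the change of variables available. *)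
Lemma cond_indep_integral (k : {mfun TU >-> pprobability TF R})
    (E : set TU) (A : set TF) (B : set TY) :
  cond_indep P U F Y -> is_cond_law P U F k ->
  measurable E -> measurable A -> measurable B ->
  P (U @^-1` E `&` (F @^-1` A `&` Y @^-1` B)) =
  \int[P]_(w in U @^-1` E `&` Y @^-1` B) k (U w) A.
Proof.
move=> FY kF mE mA mB; have [a [b [aP bP abP]]] := FY A B mA mB.
have mk := measurable_eval k mA.
pose mu : probability TU R := distribution P U.
pose nu := restr_law P U (measurable_funPTI Y mB).
have numu : nu `<< mu.
  apply/null_content_dominatesP => D mD muD; apply/eqP.
  rewrite eq_le measure_ge0 andbT -muD; apply: le_measure; rewrite ?inE//.
  - by apply: measurableI; exact: measurable_funPTI.
  - exact: measurable_funPTI.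
pose g := Radon_Nikodym (charge_of_finite_measure nu) mu.
have mg : measurable_fun setT g.
  by apply: measurable_int; exact: Radon_Nikodym_integrable.
have bg : ae_eq mu setT b g.
  apply: (is_cond_prob_ae_eq (measurable_funPTI Y mB) bP); split => // D mD.
  by rewrite -integral_distributionE// -Radon_Nikodym_integral.
have ak : ae_eq mu setT a (fun u => k u A).
  exact: (is_cond_prob_ae_eq (measurable_funPTI F mA) aP (kF A mA)).
have k0 u : 0 <= k u A by [].
(* Both sides become integrals over [E] against the law [mu] of [U]: on the right of [k u A * g u],
   on the left of [a u * b u]. *)
rewrite -(ge0_integral_restr_law _ _ (measurable_funPTI Y mB) mE mk k0)//.
rewrite -(Radon_Nikodym_change_of_variables numu)//; last first.
  apply: (@le_integrable _ _ _ _ _ mE _ (cst 1)).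
  - exact: measurable_funTS.
  - by move=> u _; rewrite gee0_abs// gee0_abs// probability_le1.
  - exact: finite_measure_integrable_cst.
have mab : measurable_fun setT (fun u => a u * b u).
  by apply: emeasurable_funM; [exact: aP.1|exact: bP.1].
rewrite abP.2// -(integral_distributionE P U mE mab).
apply: ae_eq_integral => //.
- exact: measurable_funTS.
- by apply: measurable_funTS; apply: emeasurable_funM.
- apply: ae_eq_subset (@subsetT _ E) _.
  by apply: filterS2 ak bg => u au bu _; rewrite au// bu.
Qed.

(** For a fixed target event [A], the two sides of the identity to be proved are measures [m1] and
    [m2] of the conditioning set [D]. On rectangles they agree by [cond_indep_integral]. *)
Lemma cond_indep_cond_law (W : {mfun Omega >-> (TU * TY)%type})
    (k : {mfun TU >-> pprobability TF R})
    (k' : {mfun (TU * TY)%type >-> pprobability TF R}) :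
  (forall w, W w = (U w, Y w)) -> (forall x, k' x = k x.1) ->
  cond_indep P U F Y -> is_cond_law P U F k -> is_cond_law P W F k'.
Proof.
move=> WE k'E FY kF A mA; split; first exact: measurable_eval.
have mkA : measurable_fun setT (fun w => k (U w) A).
  by apply: (measurableT_comp (measurable_eval k mA)).
have kA0 w : 0 <= k (U w) A by [].
move=> D mD; under eq_integral do rewrite k'E WE /=.
pose m1 : measure (TU * TY)%type R := restr_law P W (measurable_funPTI F mA).
pose m2 : measure (TU * TY)%type R := density_law P W mkA kA0.
apply: (@finite_measure_eq_rectangles _ _ _ _ _ m1 m2) => //.
  by rewrite -ge0_fin_numE// fin_num_measure.
move=> E B mE mB; rewrite /= /restr_law /density_law /pushforward /mrestr.
rewrite (_ : W @^-1` _ = U @^-1` E `&` Y @^-1` B); last first.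
  by apply/seteqP; split => w /=; rewrite WE.
by rewrite -(cond_indep_integral FY kF)// -setIA (setIC (Y @^-1` _)).
Qed.

End conditional_independence.

(** The restriction to [A] depends on [U] only, so it can be absorbed into the integrand [phi]. *)
Lemma integral_cond_law_in d dU dF (Omega : measurableType d)
    (TU : measurableType dU) (TF : measurableType dF) (R : realType)
    (P : probability Omega R) (U : {mfun Omega >-> TU}) (F : {mfun Omega >-> TF})
    (k : {mfun TU >-> pprobability TF R}) (phi : TU * TF -> \bar R) (A : set TU) :
  is_cond_law P U F k -> measurable_fun setT phi -> (forall x, 0 <= phi x) ->
  measurable A ->
  \int[P]_(w in U @^-1` A) phi (U w, F w) =
  \int[P]_(w in U @^-1` A) \int[k (U w)]_f phi (U w, f).
Proof.
move=> kP mphi phi0 mA.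
pose psi := phi \_ (A `*` setT).
have psiE u f : psi (u, f) = if u \in A then phi (u, f) else 0.
  by rewrite /psi patchE; congr (if _ then _ else _); apply/idP/idP;
    rewrite !inE => // -[].
transitivity (\int[P]_w psi (U w, F w)).
  rewrite integral_mkcond; apply: eq_integral => w _.
  by rewrite psiE patchE; congr (if _ then _ else _); apply/idP/idP; rewrite !inE.
rewrite (integral_cond_law kP); last 2 first.
- apply/(measurable_restrictT _ _).1; first exact: measurableX.
  exact: measurable_funTS.
- by move=> [u f]; rewrite psiE; case: ifP.
rewrite [RHS]integral_mkcond; apply: eq_integral => w _.
under eq_integral do rewrite psiE.
rewrite patchE (_ : (w \in _) = (U w \in A)); last first.
  by apply/idP/idP; rewrite !inE.
by case: ifP => // _; rewrite integral0.
Qed.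

Lemma ge0_integral_lty_fin_num d (T : measurableType d) (R : realType)
    (mu : measure T R) (D : set T) (f : T -> \bar R) :
  measurable D -> measurable_fun D f -> (forall x, 0 <= f x) ->
  \int[mu]_(x in D) f x < +oo ->
  {ae mu, forall x, D x -> f x \is a fin_num}.
Proof.
move=> mD mf f0 foo; apply: integrable_ae => //; apply/integrableP; split => //.
by under eq_integral do rewrite gee0_abs//.
Qed.

(** * Integral of the excess of a difference [g1 - g2] over a lower bound [h] *)

Section excess.
Context d (T : measurableType d) (R : realType) (mu : measure T R).
Variables (g1 g2 h : T -> \bar R).
Hypotheses (mg1 : measurable_fun setT g1) (mg2 : measurable_fun setT g2)
  (mh : measurable_fun setT h).
Hypotheses (g10 : forall x, 0 <= g1 x) (g20 : forall x, 0 <= g2 x).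
Hypothesis hg : {ae mu, forall x, h x <= g1 x - g2 x}.

Let excess x := g1 x - g2 x - h x.

(* This is the integral of [(g1 - g2 - h)^+ + g2 + h^+ = g1 + h^-], written so
   that no indeterminate difference occurs: [g1] may have an infinite
   integral. *)
Lemma ge0_integral_excess (D : set T) :
  measurable D -> \int[mu]_(x in D) g2 x < +oo -> mu.-integrable D h ->
  \int[mu]_(x in D) excess^\+ x + \int[mu]_(x in D) g2 x +
    \int[mu]_(x in D) h^\+ x =
  \int[mu]_(x in D) g1 x + \int[mu]_(x in D) h^\- x.
Proof.
move=> mD g2oo ih.
have me : measurable_fun setT excess.
  by apply: emeasurable_funB => //; exact: emeasurable_funB.
have mep := measurable_funTS (D := D) (measurable_funepos me).
have mhp := measurable_funTS (D := D) (measurable_funepos mh).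
have mhn := measurable_funTS (D := D) (measurable_funeneg mh).
have mg1D := measurable_funTS (D := D) mg1.
have mg2D := measurable_funTS (D := D) mg2.
rewrite -!ge0_integralD//; last 2 first.
- by move=> x _; rewrite adde_ge0.
- exact: emeasurable_funD.
apply: integral_ae_eq_fun.
have g2fin := ge0_integral_lty_fin_num mD mg2D g20 g2oo.
have hfin := integrable_ae mD ih.
move: hg hfin g2fin; apply: filterS3 => x hgx + + Dx => /(_ Dx) hx /(_ Dx) g2x.
rewrite !funeposE funenegE /excess.
move: hx g2x (g10 x) (g20 x) hgx.
(* [h x] and [g2 x] are finite. If [g1 x] is finite too, this is real arithmetic; if it is [+oo],
   both sides are [+oo]. *)
case: (h x) => // r _; case: (g2 x) => // s _; case: (g1 x) => [t| |]//.
  rewrite -!EFinB !lee_fin => t0 s0 rts.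
  rewrite -EFinN -!EFin_max -!EFinD; congr EFin.
  have -> : (Num.max (t - s - r) 0 = t - s - r)%R.
    by apply/max_idPl; rewrite subr_ge0.
  have [r0|r0] := leP 0%R r.
    by rewrite max_r ?oppr_le0//; lra.
  by rewrite max_l ?oppr_ge0 ?(ltW r0)//; lra.
by move=> _ _ _; rewrite /= maxye -!EFin_max.
Qed.

(** As [h] is finite almost everywhere, it can be subtracted from the bound [hg], which makes the
    excess nonnegative almost everywhere. *)
Lemma integral_excess_pos (D : set T) :
  measurable D -> mu.-integrable D h ->
  \int[mu]_(x in D) excess x = \int[mu]_(x in D) excess^\+ x.
Proof.
move=> mD ih; apply: integral_ae_eq_fun.
have hfin := integrable_ae mD ih.
move: hg hfin; apply: filterS2 => x hgx + Dx => /(_ Dx) hx.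
by rewrite funeposE; apply/esym/max_idPl; rewrite sube_ge0 ?hx ?orbT.
Qed.

End excess.

(** It reads off the integral [x] of the excess from [ge0_integral_excess]; there [a], the integral
    of [g1], may be infinite. *)
Lemma ereal_sub_sub (R : realType) (x a b c e : \bar R) :
  b \is a fin_num -> c \is a fin_num -> e \is a fin_num ->
  x + b + c = a + e -> x = a - b - (c - e).
Proof.
move: b c e => [b| |]// [c| |]// [e| |]// _ _ _.
case: x => [x| |]; case: a => [a| |]//=.
rewrite -!EFinD => -[xE]; congr EFin.
rewrite (_ : a = (a + e) - e)%R; last by ring.
by rewrite -xE; ring.
Qed.

(** It eliminates [a] and [b], which in [lhs_eq_rhs] are the integrals of [en] and [ep] over a set
    [B n]. *)
Lemma ereal_addI_cancel (R : realType) (x a b c e p m : \bar R) :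
  a \is a fin_num -> b \is a fin_num -> c \is a fin_num -> e \is a fin_num ->
  p \is a fin_num -> m \is a fin_num ->
  x + a + c = b + e -> a + p = b + m -> x + c + m = p + e.
Proof.
move: a b c e p m => [a| |]// [b| |]// [c| |]// [e| |]// [p| |]// [m| |]//.
move=> _ _ _ _ _ _; case: x => [x| |]//.
by rewrite -!EFinD => -[xE] [aE]; congr EFin; lra.
Qed.

(** * Mean excess of the conditional risk of a report over the entropy *)

Section gaps.
Context d dU dF (Omega : measurableType d) (TU : measurableType dU)
  (TF : measurableType dF) (R : realType) (P : probability Omega R).
Variables (F : {mfun Omega >-> TF}) (U : {mfun Omega >-> TU})
  (k : {mfun TU >-> pprobability TF R}).
Hypothesis kP : is_cond_law P U F k.
Variables (phi : TU * TF -> \bar R) (h : Omega -> \bar R).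
Hypotheses (mphi : measurable_fun setT phi) (ih : P.-integrable setT h).

(** This is the conditional mean of [phi (U, F)] given [U]. When [phi] is the loss of a report, it
    is the expected loss of that report under the true conditional law, and [h] stands for the
    entropy of this law. *)
Let G w := \int[k (U w)]_f phi (U w, f).

Hypothesis hG : {ae P, forall w, h w <= G w}.

Let Gp w := \int[k (U w)]_f phi^\+ (U w, f).
Let Gn w := \int[k (U w)]_f phi^\- (U w, f).

Let GE w : G w = Gp w - Gn w.
Proof.
rewrite /G integralE; congr (_ - _); apply: eq_integral => f _.
  by rewrite !funeposE.
by rewrite !funenegE.
Qed.

Let Gp0 w : 0 <= Gp w. Proof. exact: integral_ge0. Qed.

Let Gn0 w : 0 <= Gn w. Proof. exact: integral_ge0. Qed.

Let mGp : measurable_fun setT Gp.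
Proof.
apply: (measurableT_comp (f := fun u => \int[k u]_f phi^\+ (u, f))) => //.
by apply: ge0_measurable_fun_integral_mfun => //; exact: measurable_funepos.
Qed.

Let mGn : measurable_fun setT Gn.
Proof.
apply: (measurableT_comp (f := fun u => \int[k u]_f phi^\- (u, f))) => //.
by apply: ge0_measurable_fun_integral_mfun => //; exact: measurable_funeneg.
Qed.

Lemma measurable_fun_cond_mean : measurable_fun setT G.
Proof.
rewrite (_ : G = fun w => Gp w - Gn w); first exact: emeasurable_funB.
exact/funext.
Qed.

Let mh : measurable_fun setT h. Proof. exact: measurable_int ih. Qed.

Let hGpn : {ae P, forall w, h w <= Gp w - Gn w}.
Proof. by apply: filterS hG => w; rewrite GE. Qed.

Lemma integral_excess_ge0 : 0 <= \int[P]_w (G w - h w).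
Proof.
under eq_integral do rewrite GE.
by rewrite (integral_excess_pos hGpn)//; exact: integral_ge0.
Qed.

(** Disintegrating the positive and the negative part of [phi] writes the risk as the mean of [Gp]
    minus that of [Gn]. A risk other than [-oo] makes the latter finite, as [ge0_integral_excess]
    requires; a risk equal to [+oo] is allowed. *)
Lemma integral_excess_risk : \int[P]_w phi (U w, F w) != -oo ->
  \int[P]_w (G w - h w) = \int[P]_w phi (U w, F w) - \int[P]_w h w.
Proof.
have -> : \int[P]_w phi (U w, F w) = \int[P]_w Gp w - \int[P]_w Gn w.
  rewrite integralE -!(integral_cond_law kP)//.
  - congr (_ - _); apply: eq_integral => w _; first by rewrite !funeposE.
    by rewrite !funenegE.
  - exact: measurable_funeneg.
  - exact: measurable_funepos.
move=> riskNy.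
(* By convention [x - +oo] is [-oo] for every [x], including [+oo]. *)
have Gnoo : \int[P]_w Gn w < +oo.
  rewrite ltey; apply: contra riskNy => /eqP ->.
  by case: (\int[P]_w Gp w).
under eq_integral do rewrite GE.
rewrite (integral_excess_pos hGpn)// [X in _ = _ - X]integralE.
apply: ereal_sub_sub.
- by rewrite ge0_fin_numE//; exact: integral_ge0.
- exact: integrable_pos_fin_num.
- exact: integrable_neg_fin_num.
- exact: (ge0_integral_excess mGp mGn mh Gp0 Gn0 hGpn).
Qed.

(* Here the finiteness of [\int e] does not make [psi (V, F)] integrable, since
   [e] is an iterated integral.  One localizes to the sets [B n], on which the
   conditional means of the positive and negative parts of [psi] are bounded,
   and lets [n] go to infinity after moving all terms to nonnegative sides. *)
Section coarser.
Context dV (TV : measurableType dV) (V : {mfun Omega >-> TV}) (pi : TU -> TV)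
  (kV : {mfun TV >-> pprobability TF R}) (psi : TV * TF -> \bar R).
Hypotheses (mpi : measurable_fun setT pi) (VE : forall w, V w = pi (U w)).
Hypotheses (kVP : is_cond_law P V F kV) (mpsi : measurable_fun setT psi).
Hypothesis phiE : forall u f, phi (u, f) = psi (pi u, f).

Let e w := \int[kV (V w)]_f psi (V w, f).

Hypothesis ie : P.-integrable setT e.

Let ep v := \int[kV v]_f psi^\+ (v, f).
Let en v := \int[kV v]_f psi^\- (v, f).

Let eE w : e w = ep (V w) - en (V w).
Proof.
rewrite /e integralE; congr (_ - _); apply: eq_integral => f _.
  by rewrite !funeposE.
by rewrite !funenegE.
Qed.

Let ep0 v : 0 <= ep v. Proof. exact: integral_ge0. Qed.

Let en0 v : 0 <= en v. Proof. exact: integral_ge0. Qed.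

Let mep : measurable_fun setT ep.
Proof.
by apply: ge0_measurable_fun_integral_mfun => //; exact: measurable_funepos.
Qed.

Let men : measurable_fun setT en.
Proof.
by apply: ge0_measurable_fun_integral_mfun => //; exact: measurable_funeneg.
Qed.

Let A (n : nat) := [set v | ep v + en v <= n%:R%:E].

Let mA n : measurable (A n).
Proof.
rewrite -[X in measurable X]setTI.
by apply: emeasurable_fun_infty_c => //; exact: emeasurable_funD.
Qed.

Let B n := V @^-1` A n.

Let mB n : measurable (B n).
Proof. exact: measurable_funPTI. Qed.

(** Both sides disintegrate the integral of [zeta (V, F)] over [B n], one along [U] and one along
    [V]; [B n] is an event of either variable because [V] is a function of [U]. *)
Let integral_tower (xi : TU * TF -> \bar R) (zeta : TV * TF -> \bar R) n :
  measurable_fun setT xi -> (forall x, 0 <= xi x) ->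
  measurable_fun setT zeta -> (forall x, 0 <= zeta x) ->
  (forall u f, xi (u, f) = zeta (pi u, f)) ->
  \int[P]_(w in B n) \int[k (U w)]_f xi (U w, f) =
  \int[P]_(w in B n) \int[kV (V w)]_f zeta (V w, f).
Proof.
move=> mxi xi0 mzeta zeta0 xiE.
have BE : B n = U @^-1` (pi @^-1` A n).
  by apply/seteqP; split => w; rewrite /B /= VE.
rewrite -(integral_cond_law_in kVP)// BE -(integral_cond_law_in kP)//.
  by rewrite -BE; apply: eq_integral => w _; rewrite xiE VE.
by rewrite -[X in measurable X]setTI; exact: mpi.
Qed.

Let GpB n : \int[P]_(w in B n) Gp w = \int[P]_(w in B n) ep (V w).
Proof.
apply: integral_tower => //; [exact: measurable_funepos..|].
by move=> u f; rewrite !funeposE phiE.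
Qed.

Let GnB n : \int[P]_(w in B n) Gn w = \int[P]_(w in B n) en (V w).
Proof.
apply: integral_tower => //; [exact: measurable_funeneg..|].
by move=> u f; rewrite !funenegE phiE.
Qed.

Let integral_B_lty n (f : TV -> \bar R) : measurable_fun setT f -> (forall v, 0 <= f v) ->
  (forall v, f v <= ep v + en v) -> \int[P]_(w in B n) f (V w) < +oo.
Proof.
move=> mf f0 fe; apply: (@le_lt_trans _ _ (\int[P]_(w in B n) (cst n%:R%:E w))).
  apply: ge0_le_integral => //.
  - by apply: measurable_funTS; exact: measurableT_comp.
  - by move=> w Bw; apply: (le_trans (fe _)).
by rewrite integral_cst// lte_mul_pinfty// ltey_eq fin_num_measure.
Qed.

Let excess w := Gp w - Gn w - h w.

Let me : measurable_fun setT e. Proof. exact: measurable_int ie. Qed.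

Let mexcess : measurable_fun setT excess.
Proof. by apply: emeasurable_funB => //; exact: emeasurable_funB. Qed.

(** [lhs] and [rhs] come from [excess = e - h] by moving every term to the side where it is
    nonnegative. They are compared in mean only, since [excess] is conditioned on [U] and [e] on the
    coarser [V]. *)
Let lhs w := excess^\+ w + h^\+ w + e^\- w.

Let rhs w := e^\+ w + h^\- w.

Let mep1 : measurable_fun setT excess^\+.
Proof. exact: measurable_funepos. Qed.

Let mhp : measurable_fun setT h^\+. Proof. exact: measurable_funepos. Qed.

Let mhn : measurable_fun setT h^\-. Proof. exact: measurable_funeneg. Qed.

Let mep2 : measurable_fun setT e^\+. Proof. exact: measurable_funepos. Qed.

Let men2 : measurable_fun setT e^\-. Proof. exact: measurable_funeneg. Qed.

Let integral_lhs D : measurable D -> \int[P]_(w in D) lhs w =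
  \int[P]_(w in D) excess^\+ w + \int[P]_(w in D) h^\+ w +
  \int[P]_(w in D) e^\- w.
Proof.
move=> mD; rewrite ge0_integralD//.
- rewrite ge0_integralD//; exact: measurable_funTS.
- by move=> w _; rewrite adde_ge0.
- by apply: measurable_funTS; exact: emeasurable_funD.
- exact: measurable_funTS.
Qed.

Let integral_rhs D : measurable D -> \int[P]_(w in D) rhs w =
  \int[P]_(w in D) e^\+ w + \int[P]_(w in D) h^\- w.
Proof. by move=> mD; rewrite ge0_integralD//; exact: measurable_funTS. Qed.

(** On [B n] the means of [Gp] and [Gn] are those of [ep] and [en], which are finite. They cancel
    between the excess identity and the identity [en + e^\+ = ep + e^\-]. *)
Let lhs_eq_rhs n : \int[P]_(w in B n) lhs w = \int[P]_(w in B n) rhs w.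
Proof.
have epoo : \int[P]_(w in B n) ep (V w) < +oo.
  by apply: integral_B_lty => // v; rewrite leeDl.
have enoo : \int[P]_(w in B n) en (V w) < +oo.
  by apply: integral_B_lty => // v; rewrite leeDr.
have ihB : P.-integrable (B n) h by exact: integrableS ih.
have ieB : P.-integrable (B n) e by exact: integrableS ie.
have mepV : measurable_fun (B n) (ep \o V).
  by apply: measurable_funTS; exact: measurableT_comp.
have menV : measurable_fun (B n) (en \o V).
  by apply: measurable_funTS; exact: measurableT_comp.
rewrite integral_lhs// integral_rhs//.
apply: (@ereal_addI_cancel _ _ (\int[P]_(w in B n) en (V w))
  (\int[P]_(w in B n) ep (V w))).
- by rewrite ge0_fin_numE//; exact: integral_ge0.
- by rewrite ge0_fin_numE//; exact: integral_ge0.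
- exact: integrable_pos_fin_num.
- exact: integrable_neg_fin_num.
- exact: integrable_pos_fin_num.
- exact: integrable_neg_fin_num.
- rewrite -GpB -GnB; apply: (ge0_integral_excess mGp mGn mh) => //.
  by rewrite GnB.
- rewrite -!ge0_integralD//; [|exact: measurable_funTS..].
  apply: eq_integral => w; rewrite inE /B /A /= => Bw.
  rewrite funeposE funenegE eE.
  have := le_lt_trans Bw (ltry _); have := ep0 (V w); have := en0 (V w).
  case: (ep _) => [x| |]//; case: (en _) => [y| |]// _ _ _.
  rewrite -EFinB -EFinN -!EFin_max -!EFinD; congr EFin.
  have [xy|xy] := leP 0%R (x - y)%R.
    by rewrite max_r ?oppr_le0//; lra.
  by rewrite max_l ?oppr_ge0 ?(ltW xy)//; lra.
Qed.

(** Where [e], a difference of nonnegative terms, is finite, both terms are finite and their sum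
    lies below some integer. *)
Let ae_bigcupB : {ae P, forall w, (\bigcup_n B n) w}.
Proof.
have := integrable_ae measurableT ie; apply: filterS => w /(_ Logic.I).
rewrite eE; have := ep0 (V w); have := en0 (V w).
case epE : (ep _) => [x| |]//; case enE : (en _) => [y| |]// _ _ _.
exists (Num.truncn (x + y)%R).+1 => //; rewrite /B /A /= epE enE -EFinD lee_fin.
by apply: ltW; rewrite truncnS_gt.
Qed.

Let integral_bigcupB (f : Omega -> \bar R) :
  \int[P]_(w in \bigcup_n B n) f w = \int[P]_w f w.
Proof.
rewrite integral_mkcond; apply: integral_ae_eq_fun; apply: filterS ae_bigcupB.
by move=> w Bw _; rewrite patchE mem_set.
Qed.

Let cvg_integral_B (f : Omega -> \bar R) :
  measurable_fun setT f -> (forall w, 0 <= f w) ->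
  \int[P]_(w in B n) f w @[n --> \oo] --> \int[P]_w f w.
Proof.
move=> mf f0; rewrite -integral_bigcupB.
apply: ge0_nondecreasing_set_cvg_integral => //.
- move=> m n mn; apply/subsetPset => w; rewrite /B /A /= => /le_trans; apply.
  by rewrite lee_fin ler_nat.
- by move=> n; exact: measurable_funTS.
Qed.

(** With [V] the pair [(Y, C)] and [psi] the loss of the report S_Y, this is the formula for the
    communication gap. *)
Lemma integral_excess_entropy :
  \int[P]_w (G w - h w) = \int[P]_w e w - \int[P]_w h w.
Proof.
under eq_integral do rewrite GE.
rewrite (integral_excess_pos hGpn)// [X in _ = X - _]integralE.
rewrite [X in _ = _ - X]integralE.
apply: ereal_sub_sub.
- exact: integrable_neg_fin_num.
- exact: integrable_pos_fin_num.
- exact: integrable_neg_fin_num.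
rewrite -integral_rhs// addeAC -integral_lhs//.
have lhs0 w : 0 <= lhs w by rewrite !adde_ge0.
have rhs0 w : 0 <= rhs w by rewrite adde_ge0.
have mlhs : measurable_fun setT lhs.
  by apply: emeasurable_funD => //; exact: emeasurable_funD.
have mrhs : measurable_fun setT rhs by exact: emeasurable_funD.
have := cvg_integral_B mlhs lhs0; under eq_fun do rewrite lhs_eq_rhs.
by move=> /cvg_unique; apply => //; exact: cvg_integral_B.
Qed.

End coarser.

End gaps.

(** * Replacing the loss by one that agrees with it on the report class *)

Section modified_loss.
Context d dU dF (Omega : measurableType d) (TU : measurableType dU)
  (TF : measurableType dF) (R : realType) (P : probability Omega R).
Variables (Q : set (pprobability TF R)) (L L' : pprobability TF R -> TF -> \bar R).
Hypothesis LL' : forall q, Q q -> L q = L' q.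

Lemma cond_entropy_eq_in (S : Omega -> pprobability TF R) :
  {ae P, forall w, Q (S w)} -> cond_entropy P L S = cond_entropy P L' S.
Proof.
move=> SQ; apply: integral_ae_eq_fun; apply: filterS SQ => w Qw _.
by rewrite /entropy /expected_loss LL'.
Qed.

Lemma mean_divergence_eq_in (S S' : Omega -> pprobability TF R) :
  {ae P, forall w, Q (S w)} -> {ae P, forall w, Q (S' w)} ->
  mean_divergence P L S S' = mean_divergence P L' S S'.
Proof.
move=> SQ SQ'; apply: integral_ae_eq_fun; apply: filterS2 SQ SQ' => w Qw Qw' _.
by rewrite /divergence /expected_loss !LL'.
Qed.

Lemma risk_eq_in (U : Omega -> TU) (F : Omega -> TF)
    (k : {mfun TU >-> pprobability TF R}) :
  {ae P, forall w, Q (k (U w))} -> risk P L U F k = risk P L' U F k.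
Proof.
by move=> kQ; apply: integral_ae_eq_fun; apply: filterS kQ => w Qw _; rewrite LL'.
Qed.

End modified_loss.

(** * Infima, telescoping and the three gaps *)

Lemma ereal_inf_subr (R : realType) (T : Type) (V : set T) (f : T -> \bar R)
    (c : \bar R) : c \is a fin_num ->
  ereal_inf [set f x - c | x in V] = ereal_inf [set f x | x in V] - c.
Proof.
move=> cfin; apply/eqP; rewrite eq_le; apply/andP; split.
  rewrite leeBrDr//; apply: le_ereal_inf_tmp => _ [x Vx <-].
  by rewrite -leeBrDr//; apply: ereal_inf_lbound; exists x.
apply: le_ereal_inf_tmp => _ [x Vx <-].
by apply: leeB => //; apply: ereal_inf_lbound; exists x.
Qed.

Lemma ereal_sub_telescope (R : realType) (x y v r : \bar R) :
  x \is a fin_num -> y \is a fin_num -> v \is a fin_num -> r \is a fin_num ->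
  r - x = (y - x) + (v - y) + (r - v).
Proof.
case: x => // x _; case: y => // y _; case: v => // v _; case: r => // r _.
by rewrite -!EFinB -!EFinD; congr EFin; ring.
Qed.

Theorem proposition1
  (R : realType) (dO dC dX dF dY : measure_display)
  (Omega : measurableType dO) (P : probability Omega R)
  (TC : measurableType dC) (TX : measurableType dX)
  (TF : measurableType dF) (TY : measurableType dY)
  (sbC : standard_borel R TC) (sbX : standard_borel R TX)
  (sbF : standard_borel R TF) (sbY : standard_borel R TY)
  (C : {RV P >-> TC}) (X : {RV P >-> TX})
  (F : {RV P >-> TF}) (Y : {RV P >-> TY})
  (markov : cond_indep P (fun w => (X w, C w)) F Y)
  (Q : set (pprobability TF R))
  (L : pprobability TF R -> TF -> \bar R)
  (mL : trace_measurable_fun (Q `*` [set: TF]) (fun qf => L qf.1 qf.2))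
  (Lproper : proper_loss Q L)
  (kX : {mfun (TX * TC)%type >-> pprobability TF R})
  (kY : {mfun (TY * TC)%type >-> pprobability TF R})
  (kX_law : is_cond_law P (fun w => (X w, C w)) F kX)
  (kY_law : is_cond_law P (fun w => (Y w, C w)) F kY)
  (SX_Q : {ae P, forall w, Q (kX (X w, C w))})
  (SY_Q : {ae P, forall w, Q (kY (Y w, C w))})
  (V : set {mfun (TY * TC)%type >-> pprobability TF R})
  (V_neq0 : V !=set0)
  (V_Q : forall k, V k -> {ae P, forall w, Q (k (Y w, C w))})
  (ktheta : {mfun (TY * TC)%type >-> pprobability TF R})
  (ktheta_V : V ktheta) :
  let YC := fun w => (Y w, C w) in
  let SX := fun w => kX (X w, C w) in
  let SY := fun w => kY (Y w, C w) in
  let HX := cond_entropy P L SX in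
  let HY := cond_entropy P L SY in
  let HV := family_entropy P L YC F V in
  let Rtheta := risk P L YC F ktheta in
  let Delta_comm := HY - HX in
  let Delta_family := HV - HY in
  let Delta_deploy := Rtheta - HV in
  HX \is a fin_num -> HY \is a fin_num ->
  HV \is a fin_num -> Rtheta \is a fin_num ->
  [/\ HX <= HY, HY <= HV & HV <= Rtheta] /\
  Delta_comm = mean_divergence P L SX SY /\
  Delta_family =
    ereal_inf [set mean_divergence P L SY (fun w => k (YC w)) | k in V] /\
  [/\ 0 <= Delta_comm, 0 <= Delta_family & 0 <= Delta_deploy] /\
  mean_divergence P L SX (fun w => ktheta (YC w)) =
    Delta_comm + Delta_family + Delta_deploy.
Proof.
move=> YC SX SY HX HY HV Rtheta Delta_comm Delta_family Delta_deploy.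
move=> HXfin HYfin HVfin Rfin.
(* The loss is replaced by an everywhere measurable [L']. All reports lie in [Q] almost surely, so
   entropies, divergences and risks do not change. *)
have [g mg gL] := trace_measurable_fun_ext mL.
pose L' q f := g (q, f).
have LL' q : Q q -> L q = L' q.
  by move=> Qq; apply/funext => f; exact: (gL (q, f)).
have mYC : measurable_fun setT YC by exact: measurable_fun_pair.
have mXC : measurable_fun setT (fun w => (X w, C w)) by exact: measurable_fun_pair.
have mW : measurable_fun setT (fun w => ((X w, C w), Y w)).
  exact: measurable_fun_pair.
have mkX' : measurable_fun setT (kX \o fst : (TX * TC) * TY -> _).
  exact: measurableT_comp.
pose U : {mfun Omega >-> (TX * TC)%type} :=
  HB.pack (fun w => (X w, C w)) (isMeasurableFun.Build _ _ _ _ _ mXC).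
pose V' : {mfun Omega >-> (TY * TC)%type} :=
  HB.pack YC (isMeasurableFun.Build _ _ _ _ _ mYC).
pose W : {mfun Omega >-> ((TX * TC) * TY)%type} :=
  HB.pack (fun w => ((X w, C w), Y w)) (isMeasurableFun.Build _ _ _ _ _ mW).
pose kX' : {mfun ((TX * TC) * TY)%type >-> pprobability TF R} :=
  HB.pack (kX \o fst) (isMeasurableFun.Build _ _ _ _ _ mkX').
(* [pi] recovers [(Y, C)] from [W], so the loss [psi k] of a report in [(Y, C)] becomes a function
   [phi k] of [W] and [F]. *)
pose pi (u : (TX * TC) * TY) := (u.2, u.1.2).
have mpi : measurable_fun setT pi.
  by apply: measurable_fun_pair => //; exact: measurableT_comp.
have W_law : is_cond_law P W F kX'.
  exact: (@cond_indep_cond_law _ _ _ _ _ _ _ _ _ P U F Y W kX kX').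
pose psi (k : {mfun (TY * TC)%type >-> pprobability TF R}) vf := g (k vf.1, vf.2).
have mpsi k : measurable_fun setT (psi k).
  apply: measurableT_comp => //; apply: measurable_fun_pair => //.
  exact: measurableT_comp.
pose phi k (uf : ((TX * TC) * TY) * TF) := psi k (pi uf.1, uf.2).
have mphi k : measurable_fun setT (phi k).
  apply: measurableT_comp => //; apply: measurable_fun_pair => //.
  exact: measurableT_comp.
pose h w := entropy L' (SX w).
pose e w := entropy L' (SY w).
have hH : \int[P]_w h w = HX by rewrite /HX (cond_entropy_eq_in LL' SX_Q).
have eH : \int[P]_w e w = HY by rewrite /HY (cond_entropy_eq_in LL' SY_Q).
have ih : P.-integrable setT h.
  apply: integrable_of_fin_num; rewrite ?hH//.
  (* The entropy of S_X is the conditional mean given [W] of the loss of the report [kX'] itself. *)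
  apply: (measurable_fun_cond_mean W kX' (phi := fun uf => g (kX' uf.1, uf.2))).
  apply: measurableT_comp => //; apply: measurable_fun_pair => //.
  exact: measurableT_comp.
have ie : P.-integrable setT e.
  apply: integrable_of_fin_num; rewrite ?eH//.
  exact: (measurable_fun_cond_mean V' kY (phi := psi kY)).
have proper (S S' : Omega -> pprobability TF R) :
    {ae P, forall w, Q (S w)} -> {ae P, forall w, Q (S' w)} ->
    {ae P, forall w, entropy L' (S w) <= expected_loss L' (S w) (S' w)}.
  apply: filterS2 => w QS QS'; have := Lproper _ _ QS QS'.
  by rewrite /entropy /expected_loss !LL'.
have comm : mean_divergence P L SX SY = HY - HX.
  rewrite (mean_divergence_eq_in LL' SX_Q SY_Q) -hH -eH.
  exact: (integral_excess_entropy W_law (mphi kY) ih (proper _ _ SX_Q SY_Q)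
    (V := V') (psi := psi kY) mpi _ kY_law (mpsi kY) _ ie).
have comm0 : 0 <= mean_divergence P L SX SY.
  rewrite (mean_divergence_eq_in LL' SX_Q SY_Q).
  exact: (integral_excess_ge0 (U := W) (k := kX') (phi := phi kY) ih
    (proper _ _ SX_Q SY_Q)).
have riskE k : V k -> risk P L YC F k = \int[P]_w psi k (V' w, F w).
  by move=> Vk; rewrite (risk_eq_in LL' F (V_Q k Vk)).
have HV_le k : V k -> HV <= risk P L YC F k.
  by move=> Vk; apply: ereal_inf_lbound; exists k.
(* The risk of an arbitrary member of [V] may be [+oo]; the finite infimum [HV] excludes [-oo]. *)
have riskNy k : V k -> \int[P]_w psi k (V' w, F w) != -oo.
  move=> Vk; rewrite -riskE// -ltNye; apply: lt_le_trans (HV_le _ Vk).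
  by rewrite ltNye_eq HVfin.
have family k : V k -> mean_divergence P L SY (k \o YC) = risk P L YC F k - HY.
  move=> Vk; rewrite (mean_divergence_eq_in LL' SY_Q (V_Q _ Vk)) -eH riskE//.
  exact: (integral_excess_risk (U := V') kY_law (mpsi k) ie
    (proper _ _ SY_Q (V_Q _ Vk)) (riskNy k Vk)).
have family0 k : V k -> 0 <= mean_divergence P L SY (k \o YC).
  move=> Vk; rewrite (mean_divergence_eq_in LL' SY_Q (V_Q _ Vk)).
  exact: (integral_excess_ge0 (U := V') (k := kY) (phi := psi k) ie
    (proper _ _ SY_Q (V_Q _ Vk))).
have theta : mean_divergence P L SX (ktheta \o YC) = Rtheta - HX.
  rewrite (mean_divergence_eq_in LL' SX_Q (V_Q _ ktheta_V)) -hH.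
  rewrite /Rtheta riskE//.
  exact: (integral_excess_risk W_law (mphi ktheta) ih
    (proper _ _ SX_Q (V_Q _ ktheta_V)) (riskNy _ ktheta_V)).
have HXY : HX <= HY by rewrite -sube_ge0 ?HXfin// -comm.
have HYV : HY <= HV.
  apply: le_ereal_inf_tmp => _ [k Vk <-].
  by rewrite -sube_ge0 ?HYfin// -family// family0.
have HVR : HV <= Rtheta by exact: HV_le.
split; first by split.
split; first by rewrite comm.
split.
  rewrite /Delta_family -ereal_inf_subr//; congr ereal_inf.
  by apply/eq_imagel => k Vk; rewrite -family.
split; first by split; rewrite sube_ge0 ?HXfin ?HYfin ?HVfin.
rewrite [LHS]theta; exact: ereal_sub_telescope.
Qed.
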